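(* For every fixed real $\varepsilon>0$ there are some $\delta>0$ and $\eta>0$ such that the following holds for all sufficiently large primes $p$. If $H$ is a positive integer with $H>p^{\varepsilon}$ and $\mathcal{G}\subseteq\mathbb{F}_p^*$ is a multiplicative subgroup of order $T>p^{1/2-\delta}$, then, with $\mathcal{I}=\{1,\ldots,H\}$, $$S_\chi(a,\mathcal{I},\mathcal{G})=\sum_{x\in\mathcal{I}}\sum_{\lambda\in\mathcal{G}}\chi(x+a\lambda)=O(HTp^{-\eta})$$ uniformly over $a\in\mathbb{F}_p^*$ and nonprincipal multiplicative characters $\chi$ of $\mathbb{F}_p$.
   Context: $p$ denotes a prime and $\mathbb{F}_p$ the field of $p$ elements, represented by $\{0,\ldots,p-1\}$; integers are read modulo $p$ when used as elements of $\mathbb{F}_p$. A multiplicative character $\chi$ of $\mathbb{F}_p$ is extended by $\chi(0)=0$. The constant implied by $O(\cdot)$ may depend on $\varepsilon$ only; it does not depend on $p$, $H$, $\mathcal{G}$, $a$ or $\chi$. *)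

(* Defs.v *)
From HB Require Import structures.
From mathcomp Require Import all_boot all_order all_algebra all_fingroup.
From mathcomp Require Import complex.
From mathcomp Require Import reals exp.

Set Implicit Arguments.
Unset Strict Implicit.
Unset Printing Implicit Defensive.

Import Order.TTheory GRing.Theory Num.Theory.
Local Open Scope ring_scope.
Local Open Scope complex_scope.

(* A character of the multiplicative group of 'F_p, extended by chi 0 = 0;
   monoid_morphism means chi 1 = 1 and chi (x * y) = chi x * chi y, so chi is
   automatically nonzero on the nonzero elements. *)
Definition mult_char (R : realType) (p : nat) (chi : 'F_p -> R[i]) : Prop :=
  monoid_morphism chi /\ chi 0 = 0.

Definition principal (R : realType) (p : nat) (chi : 'F_p -> R[i]) : Prop :=
  forall x : 'F_p, x != 0 -> chi x = 1.

(* The integer x is read modulo p through x%:R : 'F_p; the interval is a range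
   of integers, so H may exceed p. *)
Definition char_sum (R : realType) (p : nat) (chi : 'F_p -> R[i])
    (a : 'F_p) (H : nat) (G : {group {unit 'F_p}}) : R[i] :=
  \sum_(1 <= x < H.+1) \sum_(lambda in G) chi (x%:R + a * val lambda).

(* Main.v *)
Require Import Defs.
From HB Require Import structures.
From mathcomp Require Import all_boot all_order all_algebra all_fingroup all_solvable all_field.
From mathcomp Require Import complex.
From mathcomp Require Import reals exp.
From mathcomp Require Import zify ring lra.

Set Implicit Arguments.
Unset Strict Implicit.
Unset Printing Implicit Defensive.

Import Order.TTheory GRing.Theory Num.Theory.
Local Open Scope ring_scope.
Local Open Scope complex_scope.

(** Let T be the order of the group G and n = (p - 1) / T.  Choose a character
    theta of the units of F_p whose kernel is exactly G, so that its powers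
    theta^1, ..., theta^n are all the characters trivial on G.  Expanding the
    indicator function of G in these powers gives, for x nonzero modulo p,

      n * sum_(l in G) chi (x + a * l) = sum_j c_j * chi x * theta^j x,

    where c_j is, up to a factor of modulus 1, the Jacobi sum of theta^j and
    chi, so |c_j| <= sqrt p ([sum_coset_expansion], [jacobi_norm]).  Hence,
    apart from the few x divisible by p, the double sum is at most sqrt p times
    the mean over j of |A_j|, where A_j = sum_(x <= H) chi x * theta^j x.

    If T >= p^(1/2 + eta), the trivial bound |A_j| <= H is enough.  Otherwise T
    lies within a small power of p of sqrt p, and any saving p^(- kappa) in the
    mean of |A_j| with kappa > delta is enough.  Since delta may depend on eps,
    the saving may be as small as eps dictates, and it comes from a high moment.
    By orthogonality of the theta^j ([mean_power]) the mean of |A_j|^(2k) is at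
    most the number of pairs of k-tuples of integers in [1, H] whose products
    have a ratio in G modulo p.  By the divisor bound ([exists_divisor_bound])
    an integer is such a product in only p^o(1) ways when H <= p, so it remains
    to count the pairs r, s <= H^k with r = l * s for some l in G; here k is
    taken with H^k >= sqrt p.

    That count uses only the size of G.  Cut the square [0, H^k]^2 into boxes of
    side B <= sqrt p; two points of a box satisfying the same congruence
    r = l * s differ by a vector with entries below B, so it is enough to count
    solutions with 0 < r, s < B ([card_pairs_le]).  As B^2 <= p, the class l
    determines the reduced fraction r / s, so there are few solutions
    with a small gcd (one for each l and each gcd), and few with a large gcd
    (the reduced fraction then has small height).  Balancing the two cases
    ([sum_card_short_pairs]) saves about p^(1/6) over the trivial
    count (H^k)^2. *)

(** * Small solutions of r = lambda s modulo p *)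

Lemma leq_expl m n e : (m <= n -> m ^ e <= n ^ e)%N.
Proof. by case: e => // e; rewrite leq_exp2r. Qed.

Lemma leq_card_inj_seq (T : finType) (U : eqType) (E : {set T}) (f : T -> U)
    (s : seq U) :
  {in E &, injective f} -> (forall x, x \in E -> f x \in s) ->
  (#|E| <= size s)%N.
Proof.
move=> f_inj f_s; rewrite cardE -(size_map f); apply: uniq_leq_size.
  rewrite map_inj_in_uniq ?enum_uniq // => x y.
  by rewrite !mem_enum; exact: f_inj.
by move=> _ /mapP[x + ->]; rewrite mem_enum; exact: f_s.
Qed.

Section Counting.

Variables (p : nat) (p_pr : prime p).

Lemma natr_Fp_inj r s : (r < p)%N -> (s < p)%N -> r%:R = s%:R :> 'F_p -> r = s.
Proof.
move=> rp sp /(congr1 val) /=.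
by rewrite !val_Fp_nat // !modn_small.
Qed.

Definition short_pairs (B : nat) (lambda : 'F_p) : {set 'I_B * 'I_B} :=
  [set z : 'I_B * 'I_B | [&& (0 < z.1)%N, (0 < z.2)%N & z.1%:R == lambda * z.2%:R]].

Definition ratio_pairs (I : finType) (beta : I -> 'F_p) (lambda : 'F_p) :
  {set I * I} := [set z : I * I | beta z.1 == lambda * beta z.2].

(** These range over complete boxes: for r and s both divisible by p the pair
    counts for every lambda, which the box count below accommodates. *)
Definition pairs (N : nat) (lambda : 'F_p) : {set 'I_N * 'I_N} :=
  ratio_pairs (fun r : 'I_N => r%:R) lambda.

Lemma coprime_frac_inj a b c d :
  (0 < a)%N -> (0 < c)%N ->
  coprime a b -> coprime c d -> (a * d = c * b)%N -> a = c /\ b = d.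
Proof.
move=> a0 c0 ab cd e.
have ac : (a %| c)%N by rewrite -(Gauss_dvdl _ ab) -e dvdn_mulr.
have ca : (c %| a)%N by rewrite -(Gauss_dvdl _ cd) e dvdn_mulr.
have eac : a = c by apply/eqP; rewrite eqn_dvd ac ca.
split=> //; move/eqP: e; rewrite eac eqn_pmul2l // => /eqP.
by [].
Qed.

(** With B = m ^ 3 one has B ^ 2 <= p, so two solutions for the same lambda are
    proportional: cross-multiplying gives a congruence between integers below p.
    A solution is thus fixed by lambda and its gcd g, which handles g < m ^ 2;
    when g >= m ^ 2, the reduced numerator and denominator are below m. *)
Lemma sum_card_short_pairs (m : nat) (A : {set 'F_p}) : (m ^ 6 <= p)%N ->
  (\sum_(lambda in A) #|short_pairs (m ^ 3) lambda| <= m ^ 2 * #|A| + m ^ 5)%N.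
Proof.
move=> mp; pose B := (m ^ 3)%N.
have B2 : (B * B <= p)%N by rewrite /B -expnD.
have cross (z w : 'I_B * 'I_B) lambda :
    z \in short_pairs B lambda -> w \in short_pairs B lambda ->
    (z.1 * w.2 = w.1 * z.2)%N.
  rewrite !inE => /and3P[_ z20 /eqP ez] /and3P[_ w20 /eqP ew].
  apply: natr_Fp_inj; first by apply: leq_trans B2; rewrite ltn_mul.
    by apply: leq_trans B2; rewrite ltn_mul.
  by rewrite !natrM ez ew; ring.
pose E := [set w : 'F_p * ('I_B * 'I_B) | (w.1 \in A) && (w.2 \in short_pairs B w.1)].
pose g (w : 'F_p * ('I_B * 'I_B)) := gcdn w.2.1 w.2.2.
have -> : (\sum_(lambda in A) #|short_pairs B lambda| = #|E|)%N.
  rewrite -sum1_card.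
  under eq_bigr do rewrite -sum1_card.
  rewrite pair_big_dep /=; apply: eq_bigl => w; by rewrite [in RHS]inE.
have posE w : w \in E -> [/\ (0 < w.2.1)%N, (0 < w.2.2)%N & (0 < g w)%N].
  by rewrite !inE => /and4P[_ h1 h2 _]; rewrite /g gcdn_gt0 h1.
pose F := [set w : 'F_p * ('I_B * 'I_B) | (g w < m ^ 2)%N].
rewrite -(cardsID F E) leq_add //.
(* small gcd: (lambda, gcd) determines the solution *)
- have -> : (m ^ 2 * #|A| = size [seq (l, i) | l <- enum A, i <- iota 0 (m ^ 2)])%N.
    by rewrite size_allpairs size_iota -cardE mulnC.
  apply: (@leq_card_inj_seq _ _ _ (fun w => (w.1, g w))); last first.
    move=> w; rewrite !inE -andbA => /and3P[wA _ wF].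
    apply: allpairs_f; first by rewrite mem_enum.
    by rewrite mem_iota.
  move=> w w' /setIP[wE _] /setIP[w'E _] [e1 eg].
  have [a1 b1 g1] := posE _ wE; have [a2 b2 g2] := posE _ w'E.
  move: wE w'E; rewrite !(inE, in_setI) => /andP[_ wE] /andP[_ w'E].
  have cr : (w.2.1 * w'.2.2 = w'.2.1 * w.2.2)%N.
    apply: (@cross _ _ w.1); first by rewrite inE.
    by rewrite inE e1.
  have copr (v : 'F_p * ('I_B * 'I_B)) : (0 < g v)%N ->
      coprime (v.2.1 %/ g v) (v.2.2 %/ g v).
    move=> gv; rewrite /coprime -(eqn_pmul2r gv) muln_gcdl.
    by rewrite !divnK ?dvdn_gcdl ?dvdn_gcdr // mul1n.
  have dv1 (v : 'F_p * ('I_B * 'I_B)) : (v.2.1 %/ g v * g v)%N = v.2.1.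
    by rewrite divnK // dvdn_gcdl.
  have dv2 (v : 'F_p * ('I_B * 'I_B)) : (v.2.2 %/ g v * g v)%N = v.2.2.
    by rewrite divnK // dvdn_gcdr.
  have scale_cross x y x' y' q r q' r' h h' : (q * h = x -> r * h = y ->
      q' * h' = x' -> r' * h' = y' -> x * y' = x' * y ->
      q * r' * h * h' = q' * r * h * h')%N.
    by move=> <- <- <- <- e; nia.
  have [|||||q1 q2] := @coprime_frac_inj (w.2.1 %/ g w) (w.2.2 %/ g w)
    (w'.2.1 %/ g w') (w'.2.2 %/ g w').
  + by rewrite divn_gt0 // dvdn_leq // dvdn_gcdl.
  + by rewrite divn_gt0 // dvdn_leq // dvdn_gcdl.
  + exact: copr.
  + exact: copr.
  + apply/eqP; rewrite -(eqn_pmul2r g1) -(eqn_pmul2r g2); apply/eqP.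
    exact: (scale_cross _ _ _ _ _ _ _ _ _ _ (dv1 w) (dv2 w) (dv1 w') (dv2 w') cr).
  have ea : w.2.1 = w'.2.1 by apply: val_inj; rewrite /= -(dv1 w) -(dv1 w') q1 eg.
  have eb : w.2.2 = w'.2.2 by apply: val_inj; rewrite /= -(dv2 w) -(dv2 w') q2 eg.
  rewrite (surjective_pairing w) (surjective_pairing w.2) e1 ea eb.
  by rewrite -!surjective_pairing.
(* large gcd: the reduced fraction and the gcd determine r and s, hence
   lambda = r / s *)
- have -> : (m ^ 5 = size [seq (x, z) | x <- [seq (i, j) | i <- iota 0 m, j <- iota 0 m],
      z <- iota 0 (m ^ 3)])%N.
    by rewrite !size_allpairs !size_iota mulnn -expnD.
  apply: (@leq_card_inj_seq _ _ _
    (fun w : 'F_p * ('I_B * 'I_B) => ((w.2.1 %/ g w, w.2.2 %/ g w), g w)%N)); last first.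
    move=> w /setDP[wE]; rewrite inE -leqNgt => gw.
    have [a1 b1 g1] := posE _ wE.
    have small (x : 'I_B) : (x %/ g w < m)%N.
      rewrite ltn_divLR //; apply: leq_trans (ltn_ord x) _.
      by rewrite /B expnS leq_mul2l gw orbT.
    apply: allpairs_f; first by apply: allpairs_f; rewrite mem_iota /= add0n small.
    rewrite mem_iota add0n /=; apply: leq_ltn_trans (ltn_ord w.2.1).
    by rewrite dvdn_leq // dvdn_gcdl.
  move=> w w' /setDP[wE _] /setDP[w'E _] [q1 q2 eg].
  have e1 : w.2.1 = w'.2.1.
    apply: val_inj => /=; rewrite -(divnK (dvdn_gcdl w.2.1 w.2.2)).
    by rewrite -(divnK (dvdn_gcdl w'.2.1 w'.2.2)) -!/(g _) q1 eg.
  have e2 : w.2.2 = w'.2.2.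
    apply: val_inj => /=; rewrite -(divnK (dvdn_gcdr w.2.1 w.2.2)).
    by rewrite -(divnK (dvdn_gcdr w'.2.1 w'.2.2)) -!/(g _) q2 eg.
  have [a1 b1 _] := posE _ wE.
  move: wE w'E; rewrite !inE -e1 -e2 => /and4P[_ _ _ /eqP ew] /and4P[_ _ _ /eqP ew'].
  have nz : w.2.2%:R != 0 :> 'F_p.
    apply: contraL b1 => /eqP e; rewrite -eqn0Ngt; apply/eqP.
    apply: (@natr_Fp_inj w.2.2 0) => //; last exact: prime_gt0.
    apply: leq_trans (ltn_ord w.2.2) _; apply: leq_trans B2.
    by rewrite leq_pmulr // (leq_ltn_trans _ (ltn_ord w.2.2)).
  have el : w.1 = w'.1 by apply: (mulIf nz); rewrite -ew.
  rewrite (surjective_pairing w) (surjective_pairing w.2) el e1 e2.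
  by rewrite -!surjective_pairing.
Qed.

(** In a box of side B, subtract from every solution one whose second entry is
    least.  The difference has second entry in [0, B) and first entry in
    (-B, B): it solves the congruence for lambda or, after changing the sign of
    the first entry, for - lambda. *)
Lemma card_pairs_le (N B : nat) (lambda : 'F_p) :
  lambda != 0 -> (0 < B <= p)%N ->
  (#|pairs N lambda| <= (N %/ B).+1 ^ 2 *
     (1 + (#|short_pairs B lambda| + #|short_pairs B (- lambda)|)))%N.
Proof.
move=> l0 /andP[B0 Bp].
pose key (z : 'I_N * 'I_N) : 'I_(N %/ B).+1 * 'I_(N %/ B).+1 :=
  (inord (z.1 %/ B), inord (z.2 %/ B)).
have block (i j : 'I_N) :
    inord (i %/ B) = inord (j %/ B) :> 'I_(N %/ B).+1 -> (i - j < B)%N.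
  move=> /(congr1 val) /=; rewrite !inordK ?ltnS ?leq_div2r ?(ltnW (ltn_ord _)) //.
  move=> e; rewrite (divn_eq i B) (divn_eq j B) e subnDl.
  exact: leq_ltn_trans (leq_subr _ _) (ltn_pmod _ B0).
rewrite -sum1_card (partition_big key predT) //=.
apply: (@leq_trans (\sum_(b : 'I_(N %/ B).+1 * 'I_(N %/ B).+1)
   (1 + (#|short_pairs B lambda| + #|short_pairs B (- lambda)|)))%N); last first.
  by rewrite sum_nat_const card_prod !card_ord mulnn.
apply: leq_sum => b _; rewrite sum1dep_card.
set F := finset _.
case: (pickP (mem F)) => [z' z'F | F0]; last by rewrite eq_card0.
have [z0 z0F z0min] := @arg_minnP _ z' (mem F) (fun z => val z.2) z'F.
have sh_mem (mu : 'F_p) (x y : nat) : (0 < x < B)%N -> (0 < y < B)%N ->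
    x%:R = mu * y%:R ->
    (x, y) \in [seq (val w.1, val w.2) | w <- enum (short_pairs B mu)].
  move=> /andP[x0 xB] /andP[y0 yB] e; apply/mapP.
  exists (Ordinal xB, Ordinal yB) => //.
  by rewrite mem_enum inE /= x0 y0 e eqxx.
pose P := [set z in F | (z0.1 < z.1)%N && (z0.2 < z.2)%N].
pose M := [set z in F | (z.1 < z0.1)%N && (z0.2 < z.2)%N].
have FE z : z \in F -> [/\ z.1%:R = lambda * z.2%:R :> 'F_p, (z.1 - z0.1 < B)%N,
    (z0.1 - z.1 < B)%N & (z.2 - z0.2 < B)%N].
  move: z0F; rewrite !inE => /andP[_ /eqP k0] /andP[/eqP ez /eqP kz].
  by move: kz; rewrite -k0 => -[k1 k2]; split=> //; apply: block.
have [e0 _ _ _] := FE _ z0F.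
have FPM : F \subset [set z0] :|: (P :|: M).
  apply/subsetP => z zF; have [ez b1 b1' b2] := FE _ zF.
  have := z0min _ zF; rewrite /= leq_eqVlt => /orP[/eqP e2|lt2].
    rewrite inE; apply/orP; left; rewrite inE; apply/eqP.
    have e1 : z.1%:R = z0.1%:R :> 'F_p by rewrite ez e0 e2.
    have e1' : z.1 = z0.1.
      wlog le1 : z z0 {z0F z0min P M FE e0 ez zF e2 b2} e1 b1 b1' / (z0.1 <= z.1)%N.
        move=> W; case/orP: (leq_total z0.1 z.1) => h; first exact: W.
        by apply/esym; apply: W.
      apply: val_inj; apply/eqP; rewrite eqn_leq le1 andbT -subn_eq0; apply/eqP.
      apply: (@natr_Fp_inj _ 0); rewrite ?prime_gt0 //.
        exact: leq_trans b1 Bp.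
      by rewrite natrB // e1 subrr.
    by rewrite (surjective_pairing z) (surjective_pairing z0) e1' (val_inj e2).
  apply/setUP; right; apply/setUP.
  case: (ltngtP z0.1 z.1) => [h|h|e1].
  - by left; rewrite inE zF h lt2.
  - by right; rewrite inE zF h lt2.
  have : (z.2 - z0.2)%:R = 0 :> 'F_p.
    apply: (mulfI l0); rewrite natrB ?(ltnW lt2) // mulrBr -ez -e0 e1 subrr mulr0 //.
  move/(@natr_Fp_inj _ 0) => H; move: lt2; rewrite -subn_gt0 H //.
    exact: leq_trans b2 Bp.
  exact: prime_gt0.
have sub_injr (c x y : nat) : (x - c = y - c -> c < x -> c < y -> x = y)%N by lia.
have sub_injl (c x y : nat) : (c - x = c - y -> x < c -> y < c -> x = y)%N by lia.
apply: leq_trans (subset_leq_card FPM) _.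
apply: leq_trans (leq_card_setU _ _) _; rewrite cards1 leq_add2l.
apply: leq_trans (leq_card_setU _ _) _; apply: leq_add.
- rewrite [X in (_ <= X)%N]cardE -(size_map (fun w => (val w.1, val w.2))).
  apply: (@leq_card_inj_seq _ _ _ (fun z : 'I_N * 'I_N => (z.1 - z0.1, z.2 - z0.2)%N)).
    move=> z w; rewrite !inE => /and3P[_ z1 z2] /and3P[_ w1 w2] [d1 d2].
    rewrite (surjective_pairing z) (surjective_pairing w).
    by congr (_, _); apply: val_inj; [apply: (sub_injr _ _ _ d1) | apply: (sub_injr _ _ _ d2)].
  move=> z; rewrite inE => /and3P[zF z1 z2].
  have [ez b1 b1' b2] := FE _ zF.
  apply: sh_mem; rewrite ?subn_gt0 ?z1 ?z2 //.
  by rewrite !natrB ?(ltnW z1) ?(ltnW z2) // ez e0 mulrBr.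
- rewrite [X in (_ <= X)%N]cardE -(size_map (fun w => (val w.1, val w.2))).
  apply: (@leq_card_inj_seq _ _ _ (fun z : 'I_N * 'I_N => (z0.1 - z.1, z.2 - z0.2)%N)).
    move=> z w; rewrite !inE => /and3P[_ z1 z2] /and3P[_ w1 w2] [d1 d2].
    rewrite (surjective_pairing z) (surjective_pairing w).
    by congr (_, _); apply: val_inj; [apply: (sub_injl _ _ _ d1) | apply: (sub_injr _ _ _ d2)].
  move=> z; rewrite inE => /and3P[zF z1 z2].
  have [ez b1 b1' b2] := FE _ zF.
  apply: sh_mem; rewrite ?subn_gt0 ?z1 ?z2 //.
  by rewrite !natrB ?(ltnW z1) ?(ltnW z2) // ez e0; ring.
Qed.

Lemma sum_card_pairs (m N : nat) (A : {set 'F_p}) :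
  (0 < m)%N -> (m ^ 6 <= p)%N -> 0 \notin A ->
  (\sum_(lambda in A) #|pairs N lambda| <=
     (N %/ m ^ 3).+1 ^ 2 * (3 * m ^ 2 * #|A| + 2 * m ^ 5))%N.
Proof.
move=> m0 mp A0.
have Bp : (0 < m ^ 3 <= p)%N.
  by rewrite expn_gt0 m0 /= (leq_trans _ mp) // leq_pexp2l.
apply: (@leq_trans (\sum_(l in A) (N %/ m ^ 3).+1 ^ 2 *
   (1 + (#|short_pairs (m ^ 3) l| + #|short_pairs (m ^ 3) (- l)|)))%N).
  apply: leq_sum => l lA; apply: card_pairs_le => //.
  by apply: contraNneq A0 => <-.
rewrite -big_distrr leq_mul // !big_split /= sum1_card.
have h1 := sum_card_short_pairs A mp.
have h2 := sum_card_short_pairs (-%R @^-1: A) mp.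
have cA : #|-%R @^-1: A| = #|A| by rewrite on_card_preimset //; exists -%R => x _; rewrite opprK.
(* the solutions for - lambda are those for the set - A, of the same size *)
have e2 : (\sum_(l in A) #|short_pairs (m ^ 3) (- l)| =
    \sum_(l in -%R @^-1: A) #|short_pairs (m ^ 3) l|)%N.
  rewrite [RHS](reindex_inj oppr_inj) /=; apply: eq_bigl => l.
  by rewrite inE opprK.
rewrite e2; rewrite cA in h2.
have h3 : (#|A| <= m ^ 2 * #|A|)%N by rewrite leq_pmull // expn_gt0 m0.
apply: leq_trans (leq_add h3 (leq_add h1 h2)) _.
by rewrite -mulnA; move: (m ^ 2 * #|A|)%N (m ^ 5)%N => x y; lia.
Qed.

End Counting.

(** * The divisor bound and fibres of the product map *)

Lemma size_divisors_part q n : prime q -> (0 < n)%N ->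
  (size (divisors n) <= (logn q n).+1 * size (divisors n`_q^'))%N.
Proof.
move=> q_pr n0; rewrite -[X in (X * _)%N](size_iota 0) -(size_allpairs pair).
rewrite -(size_map (fun d => (logn q d, d`_q^')%N)); apply: uniq_leq_size.
  rewrite map_inj_in_uniq ?divisors_uniq // => d e.
  rewrite -!dvdn_divisors // => dn en [lde pde].
  have [d0 e0] : (0 < d)%N /\ (0 < e)%N by rewrite !(dvdn_gt0 n0).
  by rewrite -(partnC q d0) -(partnC q e0) !p_part lde pde.
move=> _ /mapP[d + ->]; rewrite -dvdn_divisors // => dn.
apply: allpairs_f; first by rewrite mem_iota add0n ltnS dvdn_leq_log.
by rewrite -dvdn_divisors ?part_gt0 // partn_dvd.
Qed.

(** The number of divisors is O(n ^ (1 / m)) for every m.  A prime power q ^ a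
    has a + 1 divisors, and (a + 1) ^ m <= q ^ a as soon as q >= 2 ^ m; each of
    the fewer than 2 ^ m smaller primes costs a constant factor m ^ m. *)
Lemma exists_divisor_bound m : (0 < m)%N ->
  exists C, forall n, (0 < n)%N -> (size (divisors n) ^ m <= C * n)%N.
Proof.
move=> m0; pose small (n : nat) := count (fun q => q < 2 ^ m)%N (primes n).
have C0 : (0 < m ^ m)%N by rewrite expn_gt0 m0.
have succ_le a : (a.+1 <= 2 ^ a)%N by exact: ltn_expl.
have prime_le q a : prime q -> ((a.+1) ^ m <= (m ^ m) ^ (q < 2 ^ m) * q ^ a)%N.
  move=> q_pr; case: ltnP => hq.
    (* a + 1 <= m * (a %/ m + 1) <= m * 2 ^ (a %/ m) *)
    apply: (@leq_trans ((m * 2 ^ (a %/ m)) ^ m)%N).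
      rewrite leq_exp2r //; apply: leq_trans (leq_mul (leqnn m) (succ_le _)).
      by rewrite mulnC ltn_ceil.
    rewrite expnMn expn1 leq_mul2l -expnM; apply/orP; right.
    apply: (@leq_trans (2 ^ a)%N); first by rewrite leq_exp2l // leq_trunc_div.
    by rewrite leq_expl // prime_gt1.
  rewrite expn0 mul1n; apply: (@leq_trans ((2 ^ m) ^ a)%N).
    by rewrite -expnM mulnC expnM leq_exp2r.
  exact: leq_expl.
have bound n : (0 < n)%N -> (size (divisors n) ^ m <= (m ^ m) ^ small n * n)%N.
  elim/ltn_ind: n => n IH n0.
  have [n1|n1] := leqP n 1.
    have -> : n = 1%N by apply/eqP; rewrite eqn_leq n1.
    by rewrite /= exp1n muln1 expn_gt0 C0.
  pose q := pdiv n; have q_pr : prime q := pdiv_prime n1.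
  have qn : q \in primes n by rewrite mem_primes q_pr n0 pdiv_dvd.
  have n'0 : (0 < n`_q^')%N := part_gt0 _ _.
  have nE : (q ^ logn q n * n`_q^' = n)%N by rewrite -p_part partnC.
  have n'n : (n`_q^' < n)%N.
    rewrite -[X in (_ < X)%N]nE ltn_Pmull //.
    by rewrite -(exp1n (logn q n)) ltn_exp2r ?prime_gt1 // logn_gt0.
  have smallE : small n = ((q < 2 ^ m) + small n`_q^')%N.
    rewrite /small (seq.permP (perm_to_rem qn)) primes_part rem_filter ?primes_uniq //=.
  apply: (@leq_trans (((logn q n).+1 * size (divisors n`_q^')) ^ m)%N).
    by rewrite leq_exp2r // size_divisors_part.
  rewrite expnMn; apply: leq_trans (leq_mul (prime_le q _ q_pr) (IH _ n'n n'0)) _.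
  by rewrite mulnACA nE smallE expnD.
exists ((m ^ m) ^ 2 ^ m)%N => n n0; apply: leq_trans (bound n n0) _.
rewrite leq_mul2r; apply/orP; right; apply: leq_pexp2l => //.
rewrite /small -size_filter -[X in (_ <= X)%N](size_iota 0).
apply: uniq_leq_size; first by rewrite filter_uniq // primes_uniq.
by move=> r; rewrite mem_filter mem_iota => /andP[].
Qed.

(** The entries of f are shifted by one, so that they range over [1, H]. *)
Definition tprod (H k : nat) (f : {ffun 'I_k -> 'I_H}) : nat :=
  (\prod_i (f i).+1)%N.

Lemma tprod_gt0 H k (f : {ffun 'I_k -> 'I_H}) : (0 < tprod f)%N.
Proof. by rewrite prodn_gt0. Qed.

Lemma tprod_le H k (f : {ffun 'I_k -> 'I_H}) : (tprod f <= H ^ k)%N.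
Proof.
rewrite -[X in (_ ^ X)%N]card_ord -prod_nat_const; apply: leq_prod => i _.
exact: ltn_ord.
Qed.

Lemma card_tprod_divisors H k r :
  (#|[set f : {ffun 'I_k -> 'I_H} | tprod f == r]| <= size (divisors r) ^ k)%N.
Proof.
have [->|r0] := posnP r.
  rewrite (_ : finset _ = set0) ?cards0 //; apply/setP => f.
  by rewrite !inE; apply: negbTE; rewrite -lt0n tprod_gt0.
pose D := [set i : 'I_H | (i.+1 %| r)%N].
have cD : (#|D| <= size (divisors r))%N.
  apply: (@leq_card_inj_seq _ _ _ (fun i : 'I_H => i.+1)).
    by move=> i j _ _ [] /val_inj.
  by move=> i; rewrite inE -dvdn_divisors.
apply: leq_trans (leq_expl k cD).
rewrite -[X in (_ ^ X)%N]card_ord -card_ffun_on.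
apply: subset_leq_card; apply/subsetP => f; rewrite inE => /eqP fr.
apply/ffun_onP => i; rewrite inE.
by rewrite -fr /tprod (bigD1 i) //= dvdn_mulr.
Qed.

(** The case k = 1 serves large H: here the fibres stay trivial however much H
    exceeds p, while divisor counts are not controlled in terms of p. *)
Lemma card_tprod1 H r : (#|[set f : {ffun 'I_1 -> 'I_H} | tprod f == r]| <= 1)%N.
Proof.
apply/card_le1_eqP => f g; rewrite !inE /tprod !big_ord1 => /eqP ef /eqP eg.
apply/ffunP => i; rewrite (ord1 i); apply: val_inj; move: eg.
by rewrite -ef => -[].
Qed.

Definition tprod_pairs p H k (lambda : 'F_p) :
    {set {ffun 'I_k -> 'I_H} * {ffun 'I_k -> 'I_H}} :=
  ratio_pairs (fun f => (tprod f)%:R) lambda.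

Lemma card_tprod_pairs p H k M (lambda : 'F_p) :
  (forall r, #|[set f : {ffun 'I_k -> 'I_H} | tprod f == r]| <= M)%N ->
  (#|tprod_pairs H k lambda| <= M ^ 2 * #|pairs (H ^ k).+1 lambda|)%N.
Proof.
move=> hM.
pose key (z : {ffun 'I_k -> 'I_H} * {ffun 'I_k -> 'I_H}) :
  'I_(H ^ k).+1 * 'I_(H ^ k).+1 := (inord (tprod z.1), inord (tprod z.2)).
have ordK (f : {ffun 'I_k -> 'I_H}) :
    (inord (tprod f) : 'I_(H ^ k).+1) = tprod f :> nat.
  by rewrite inordK // ltnS tprod_le.
rewrite -sum1_card (partition_big key (mem (pairs (H ^ k).+1 lambda))) /=; last first.
  by move=> z; rewrite !inE /= !ordK.
rewrite mulnC -sum_nat_const; apply: leq_sum => -[r s] _.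
rewrite sum1dep_card.
apply: (@leq_trans #|setX [set f : {ffun 'I_k -> 'I_H} | tprod f == r]
                         [set f : {ffun 'I_k -> 'I_H} | tprod f == s]|).
  apply: subset_leq_card; apply/subsetP => -[f g]; rewrite !inE /=.
  by move=> /andP[_ /eqP[<- <-]]; rewrite !ordK !eqxx.
by rewrite cardsX -mulnn leq_mul.
Qed.

(** * A character with prescribed kernel *)

Section Characters.

Variable C : numClosedFieldType.

Lemma prim_root_exists n : (0 < n)%N -> exists z : C, n.-primitive_root z.
Proof.
move=> n0; have [r Dr] := closed_field_poly_normal ('X^n - 1 : {poly C}).
rewrite (monicP _) ?monicXnsubC // scale1r in Dr.
have r1 : all n.-unity_root r by apply/allP=> z; rewrite -root_prod_XsubC -Dr.
have sz_r : (n < (size r).+1)%N.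
  by rewrite -(size_prod_XsubC r id) -Dr size_XnsubC.
have [|z _ zP] := hasP (has_prim_root n0 r1 _ sz_r); last by exists z.
by rewrite -separable_prod_XsubC -Dr separable_Xn_sub_1 // pnatr_eq0 -lt0n.
Qed.

Variables (p : nat) (p_pr : prime p).

Lemma Fp_unitE (x : 'F_p) : x != 0 -> exists u : {unit 'F_p}, val u = x.
Proof. by rewrite -unitfE => xu; exists (FinRing.unit 'F_p xu). Qed.

Lemma unit_Fp_neq0 (u : {unit 'F_p}) : val u != 0.
Proof. by rewrite -unitfE; exact: valP. Qed.

(** The units are cyclic, generated by some w, and G is generated by w ^ n where
    n is its index; theta sends w to a primitive n-th root of unity. *)
Lemma char_with_kernel (G : {group {unit 'F_p}}) :
  exists (n : nat) (theta : 'F_p -> C),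
  [/\ (n * #|G| = p.-1)%N, monoid_morphism theta /\ theta 0 = 0 &
      forall u, theta (val u) ^+ n = 1 /\ (theta (val u) == 1) = (u \in G)].
Proof.
have /cyclicP[w wE] := field_unit_group_cyclic [set: {unit 'F_p}]%G.
have ow : #[w]%g = p.-1 by rewrite /order -wE card_finField_unit card_Fp.
have TG : (#|G| %| #[w]%g)%N by rewrite /order -wE cardSg ?subsetT.
pose n := (#[w]%g %/ #|G|)%N; have nT : (n * #|G| = #[w]%g)%N by rewrite divnK.
have n0 : (0 < n)%N by rewrite divn_gt0 ?cardG_gt0 // dvdn_leq ?order_gt0.
have nw : (n %| #[w]%g)%N by rewrite -nT dvdn_mulr.
have GE : G :=: <[w ^+ n]>%g.
  apply/eqP; rewrite (@eq_subG_cyclic _ [set: {unit 'F_p}]%G) ?subsetT //; last first.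
    by apply/cyclicP; exists w.
  by rewrite -orderE orderXdiv // /n divnA // mulKn ?order_gt0.
have [z zP] := prim_root_exists n0.
have /fin_all_exists[lg lgE] (x : 'F_p) :
    exists i, x != 0 -> x = val (w ^+ i)%g.
  have [->|x0] := eqVneq x 0; first by exists 0%N.
  have [u <-] := Fp_unitE x0.
  have /cycleP[i ->] : u \in <[w]>%g by rewrite -wE inE.
  by exists i.
pose theta (x : 'F_p) : C := if x == 0 then 0 else z ^+ lg x.
have thetaE i : theta (val (w ^+ i)%g) = z ^+ i.
  rewrite /theta (negbTE (unit_Fp_neq0 _)).
  have /val_inj/eqP := lgE _ (unit_Fp_neq0 (w ^+ i)%g).
  rewrite eq_expg_mod_order => /eqP h; apply/eqP.
  rewrite (eq_prim_root_expr zP); apply/eqP.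
  by rewrite -(modn_dvdm i nw) h modn_dvdm.
exists n, theta; split; first by rewrite nT.
- split; last by rewrite /theta eqxx.
  split; first by have := thetaE 0%N; rewrite expr0 expg0.
  move=> x y; have [->|x0] := eqVneq x 0; first by rewrite mul0r /theta eqxx mul0r.
  have [->|y0] := eqVneq y 0; first by rewrite mulr0 /theta eqxx mulr0.
  by rewrite (lgE x x0) (lgE y y0) -FinRing.val_unitM -expgD !thetaE exprD.
move=> u; have /cycleP[i ->] : u \in <[w]>%g by rewrite -wE inE.
rewrite thetaE; split; first by rewrite exprAC (prim_expr_order zP) expr1n.
rewrite -(prim_order_dvd zP) GE; apply/idP/cycleP => [/dvdnP[j ->]|[j]].
  by exists j; rewrite -expgM mulnC.
rewrite -expgM => /eqP; rewrite eq_expg_mod_order => /eqP h.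
by rewrite /dvdn -(modn_dvdm i nw) h modn_dvdm // modnMr.
Qed.

End Characters.

(** * Multiplicative characters and Jacobi sums *)

Section MultChar.

Variables (C : numClosedFieldType) (p : nat) (p_pr : prime p).
Implicit Types psi phi chi : 'F_p -> C.

(** The predicate of the statement, for characters with values in an arbitrary
    [numClosedFieldType]. *)
Definition mchar psi := monoid_morphism psi /\ psi 0 = 0.

Lemma mchar_mul psi phi : mchar psi -> mchar phi ->
  mchar (fun x => psi x * phi x).
Proof.
move=> [[p1 pM] p0] [[f1 fM] f0]; split; last by rewrite p0 mul0r.
by split=> [|x y]; rewrite ?p1 ?f1 ?mulr1 // pM fM mulrACA.
Qed.

Lemma mchar_exp psi j : mchar psi -> mchar (fun x => psi x ^+ j.+1).
Proof.
move=> [[p1 pM] p0]; split; last by rewrite p0 expr0n.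
by split=> [|x y]; rewrite ?p1 ?expr1n // pM exprMn.
Qed.

Lemma mchar_norm psi x : mchar psi -> x != 0 -> `|psi x| = 1.
Proof.
move=> [[p1 pM] p0] x0.
have pX n : psi (x ^+ n) = psi x ^+ n.
  by elim: n => [|n IH]; rewrite ?expr0 // !exprS pM IH.
have : x ^+ p.-1 = 1.
  apply: (mulfI x0); rewrite mulr1 -exprS prednK ?prime_gt0 //.
  by have := expf_card x; rewrite card_Fp.
move/(congr1 psi); rewrite pX p1 => /(congr1 Num.norm).
rewrite normrX normr1 => /eqP; rewrite pexpr_eq1 ?normr_ge0 //; last first.
  by rewrite -subn1 subn_gt0 prime_gt1.
by move/eqP.
Qed.

Lemma mchar_norm_le1 psi x : mchar psi -> `|psi x| <= 1.
Proof.
move=> pP; have [->|x0] := eqVneq x 0; first by rewrite pP.2 normr0.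
by rewrite mchar_norm.
Qed.

(** Also true at x = 0, where both sides vanish. *)
Lemma mchar_inv psi x : mchar psi -> psi x^-1 = ((psi x)^*)%R.
Proof.
move=> pP; have [->|x0] := eqVneq x 0.
  by rewrite invr0 pP.2 conjC0.
have : psi x * psi x^-1 = 1 by rewrite -pP.1.2 mulfV // pP.1.1.
have nz : psi x != 0 by rewrite -normr_eq0 mchar_norm // oner_eq0.
move=> e; apply: (mulfI nz); rewrite e -normCK mchar_norm // expr1n //.
Qed.

Lemma sum_mchar psi : mchar psi ->
  \sum_x psi x = 0 \/ forall x, x != 0 -> psi x = 1.
Proof.
move=> pP; have [/forall_inP h|] := boolP [forall (x | x != 0), psi x == 1].
  by right=> x x0; apply/eqP/h.
case/forall_inPn => y y0 py; left.
have : psi y * \sum_x psi x = \sum_x psi x.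
  rewrite big_distrr [RHS](reindex (fun x => y * x)) /=.
    by apply: eq_bigr => x _; rewrite -pP.1.2.
  by exists (fun x => y^-1 * x) => x _; rewrite ?mulKf ?mulVKf.
move=> e; apply/eqP; have /eqP : (psi y - 1) * \sum_x psi x = 0.
  by rewrite mulrBl mul1r e subrr.
by rewrite mulf_eq0 subr_eq0 (negbTE py).
Qed.

Lemma sum_mchar_ge0 psi : mchar psi -> 0 <= \sum_x psi x.
Proof.
move=> pP; case: (sum_mchar pP) => [-> //|h].
apply: sumr_ge0 => x _; have [->|x0] := eqVneq x 0; first by rewrite pP.2.
by rewrite h // ler01.
Qed.

Definition jacobi psi chi := \sum_y psi y * chi (1 - y).

(** The substitution z = 1 - 1 / v turns (1 - t z) / (1 - z) into
    (1 - t) v + t, which runs over all residues unless t = 1; the two corrections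
    account for v = 0 and for z = 0. *)
Lemma jacobi_kernel chi t : mchar chi -> \sum_x chi x = 0 ->
  \sum_(z | z != 0) chi ((1 - t * z) / (1 - z)) =
    (t == 1)%:R * p%:R - chi t - 1.
Proof.
move=> cP sc.
have -> : (t == 1)%:R * p%:R = \sum_v chi ((1 - t) * v + t).
  have [->|t1] := eqVneq t 1.
    rewrite mul1r subrr; under eq_bigr do rewrite mul0r add0r cP.1.1.
    by rewrite sumr_const card_Fp.
  have t1' : 1 - t != 0 by rewrite subr_eq0 eq_sym.
  rewrite mul0r -[LHS]sc [LHS](reindex (fun v => (1 - t) * v + t)) //=.
  exists (fun v => (v - t) / (1 - t)) => v _.
    by rewrite addrK mulrC mulKf.
  by rewrite mulrC divfK // subrK.
have -> : \sum_(z | z != 0) chi ((1 - t * z) / (1 - z)) =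
    \sum_z chi ((1 - t * z) / (1 - z)) - 1.
  by rewrite [in RHS](bigD1 0 isT) /= mulr0 subr0 divr1 cP.1.1 addrAC subrr add0r.
congr (_ - 1).
rewrite (reindex (fun v => 1 - v^-1)) /=; last first.
  by exists (fun z => (1 - z)^-1) => z _; rewrite ?invrK subKr ?invrK.
rewrite (bigD1 0 isT) [in RHS](bigD1 0 isT) /=.
rewrite invr0 !subr0 subrr invr0 !mulr0 cP.2 !add0r addrC addrK.
apply: eq_bigr => v v0; congr chi.
by rewrite subKr invrK; field.
Qed.

(** Writing the square as a double sum over y and z and putting y = t z gives
    the sum over t of psi t times the kernel of the previous lemma, that is
    p - sum psi - sum (psi chi); a complete character sum is never negative. *)
Lemma jacobi_norm psi chi : mchar psi -> mchar chi -> \sum_x chi x = 0 ->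
  `|jacobi psi chi| ^+ 2 <= p%:R.
Proof.
move=> pP cP sc.
have -> : `|jacobi psi chi| ^+ 2 = \sum_t psi t * ((t == 1)%:R * p%:R - chi t - 1).
  rewrite normCK {2}/jacobi rmorph_sum /= big_distrr /= (bigD1 0 isT) /=.
  rewrite pP.2 mul0r conjC0 mulr0 add0r.
  under [RHS]eq_bigr => t _ do rewrite -(jacobi_kernel t cP sc) big_distrr /=.
  rewrite exchange_big /=; apply: eq_bigr => z z0.
  rewrite /jacobi (reindex (fun t => t * z)) /=; last first.
    by exists (fun t => t / z) => t _; rewrite ?mulfK ?divfK.
  rewrite big_distrl /=; apply: eq_bigr => t _.
  by rewrite rmorphM /= -!mchar_inv // mulrACA -pP.1.2 -cP.1.2 mulfK.
under eq_bigr do rewrite !mulrBr mulr1.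
rewrite !sumrB (bigD1 1 isT) /= ?eqxx mul1r pP.1.1 mul1r big1 ?addr0; last first.
  by move=> t /negbTE->; rewrite mul0r mulr0.
rewrite -addrA -opprD gerBl addr_ge0 ?sum_mchar_ge0 //.
exact: mchar_mul.
Qed.

End MultChar.

(** * Expansion over the characters trivial on a subgroup *)

Section MeanValue.

Variables (C : numClosedFieldType) (p : nat) (p_pr : prime p).
Variables (G : {group {unit 'F_p}}) (n : nat) (theta : 'F_p -> C).
Hypothesis theta_char : mchar theta.
Hypothesis theta_ker : forall u : {unit 'F_p},
  theta (val u) ^+ n = 1 /\ (theta (val u) == 1) = (u \in G).

(** The exponents run over 1, ..., n rather than 0, ..., n - 1 so that every
    term vanishes at y = 0. *)
Lemma theta_orthogonal y :
  \sum_(j < n) theta y ^+ j.+1 = n%:R * (theta y == 1)%:R.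
Proof.
have [->|y0] := eqVneq y 0.
  rewrite theta_char.2 eq_sym oner_eq0 mulr0 big1 // => j _.
  by rewrite expr0n.
have [u <-] := Fp_unitE y0; have [un _] := theta_ker u.
under eq_bigr do rewrite exprS; rewrite -big_distrr /=.
have [->|u1] := eqVneq (theta (val u)) 1.
  by rewrite mul1r mulr1; under eq_bigr do rewrite expr1n; rewrite sumr_const card_ord.
have := subrX1 (theta (val u)) n; rewrite un subrr => /esym/eqP.
by rewrite mulf_eq0 subr_eq0 (negbTE u1) /= => /eqP->; rewrite !mulr0.
Qed.

Lemma sum_group (f : 'F_p -> C) :
  \sum_(lambda in G) f (val lambda) = \sum_y (theta y == 1)%:R * f y.
Proof.
rewrite [RHS](bigD1 0 isT) /= theta_char.2 eq_sym oner_eq0 mul0r add0r.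
rewrite [RHS](reindex (val : {unit 'F_p} -> 'F_p)) /=; last first.
  exists (insubd (1%g : {unit 'F_p})) => y y0; first by rewrite valKd.
  by apply: insubdK; rewrite -topredE /= unitfE.
rewrite [RHS](eq_bigl xpredT); last by move=> u; rewrite unit_Fp_neq0.
rewrite big_mkcond /=; apply: eq_bigr => u _.
by rewrite (theta_ker u).2; case: ifP; rewrite ?mul1r ?mul0r.
Qed.

(** Expand the indicator of G by orthogonality and substitute
    y = - (x / a) z, so that x + a y = x (1 - z); what is left of the sum over y
    is a Jacobi sum independent of x. *)
Lemma sum_coset_expansion (chi : 'F_p -> C) a : mchar chi -> \sum_x chi x = 0 -> a != 0 ->
  exists c : 'I_n -> C, (forall j, `|c j| ^+ 2 <= p%:R) /\
    forall x, x != 0 ->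
    n%:R * \sum_(lambda in G) chi (x + a * val lambda) =
    \sum_j c j * (chi x * theta x ^+ j.+1).
Proof.
move=> cP sc a0.
have na0 : - a^-1 != 0 by rewrite oppr_eq0 invr_eq0.
exists (fun j : 'I_n => theta (- a^-1) ^+ j.+1 *
  jacobi (fun x => theta x ^+ j.+1) chi); split.
  move=> j; rewrite normrM normrX mchar_norm // expr1n mul1r.
  by apply: jacobi_norm => //; exact: mchar_exp.
move=> x x0; rewrite (sum_group (fun y => chi (x + a * y))) big_distrr /=.
under eq_bigr do rewrite mulrA -theta_orthogonal big_distrl /=.
rewrite exchange_big /=; apply: eq_bigr => j _.
have b0 : x * - a^-1 != 0 by rewrite mulf_neq0.
rewrite (reindex (fun z => x * - a^-1 * z)) /=; last first.
  by exists (fun z => (x * - a^-1)^-1 * z) => z _; rewrite ?mulKf ?mulVKf.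
rewrite /jacobi big_distrr big_distrl /=; apply: eq_bigr => z _.
have -> : x + a * (x * - a^-1 * z) = x * (1 - z) by field.
by rewrite !theta_char.1.2 cP.1.2 !exprMn; ring.
Qed.

(** Opening the square, the sum over j detects beta i / beta i' in G. *)
Lemma mean_square (I : finType) (alpha : I -> C) (beta : I -> 'F_p) :
  (forall i, `|alpha i| <= 1) ->
  \sum_(j < n) `|\sum_i alpha i * theta (beta i) ^+ j.+1| ^+ 2 <=
  n%:R * (\sum_(lambda in G)
    #|ratio_pairs beta (val lambda)|)%:R.
Proof.
move=> a1.
have E : \sum_(j < n) `|\sum_i alpha i * theta (beta i) ^+ j.+1| ^+ 2 =
    \sum_(z : I * I) alpha z.1 * (alpha z.2)^*%R *
      (n%:R * (theta (beta z.1 / beta z.2) == 1)%:R).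
  under [RHS]eq_bigr do rewrite -theta_orthogonal big_distrr /=.
  rewrite [RHS]exchange_big /=; apply: eq_bigr => j _.
  rewrite normCK rmorph_sum /= big_distrlr /= pair_bigA /=.
  apply: eq_bigr => -[i i'] _ /=.
  by rewrite rmorphM rmorphXn /= -(mchar_inv p_pr) // theta_char.1.2 exprMn; ring.
rewrite -[X in X <= _]ger0_norm; last by apply: sumr_ge0 => j _; rewrite exprn_ge0.
rewrite E; apply: le_trans (ler_norm_sum _ _ _) _.
apply: (@le_trans _ _ (\sum_(z : I * I) n%:R *
   (\sum_(lambda in G) nat_of_bool (beta z.1 == val lambda * beta z.2)%R)%:R)).
  apply: ler_sum => z _; rewrite normrM.
  apply: (@le_trans _ _ (n%:R * (theta (beta z.1 / beta z.2) == 1)%:R)).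
    rewrite [X in _ * X]ger0_norm ?mulr_ge0 ?ler0n //.
    rewrite ler_piMl ?mulr_ge0 ?ler0n // normrM norm_conjC.
    by rewrite mulr_ile1 ?normr_ge0.
  apply: ler_wpM2l; first exact: ler0n.
  rewrite ler_nat; case: eqP => // th1.
  have nz : beta z.1 / beta z.2 != 0.
    by apply/eqP => e; move/eqP: th1; rewrite e theta_char.2 eq_sym oner_eq0.
  have [u uE] := Fp_unitE nz.
  have z20 : beta z.2 != 0 by move: nz; rewrite mulf_eq0 invr_eq0 => /norP[].
  have uG : u \in G by rewrite -(theta_ker u).2 uE th1.
  by rewrite (bigD1 u) //= uE divfK // eqxx.
rewrite -big_distrr /= -natr_sum exchange_big /=.
rewrite ler_wpM2l ?ler0n // ler_nat; apply: leq_sum => l _.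
by rewrite -sum1dep_card [X in (_ <= X)%N]big_mkcond.
Qed.

(** The k-th power of the inner sum is a sum over k-tuples, to which the mean
    square applies. *)
Lemma mean_power (chi : 'F_p -> C) H k : mchar chi ->
  \sum_(j < n) `|\sum_(x < H) chi x.+1%:R * theta x.+1%:R ^+ j.+1| ^+ k.*2 <=
  n%:R * (\sum_(lambda in G) #|tprod_pairs H k (val lambda)|)%:R.
Proof.
move=> cP.
have mX (psi : 'F_p -> C) (f : {ffun 'I_k -> 'I_H}) : mchar psi ->
    \prod_i psi (f i).+1%:R = psi (tprod f)%:R.
  move=> pP; rewrite /tprod natr_prod.
  by elim/big_rec2: _ => [|i y x _ ->]; rewrite ?pP.1.1 ?pP.1.2.
have E (j : 'I_n) :
    `|\sum_(x < H) chi x.+1%:R * theta x.+1%:R ^+ j.+1| ^+ k.*2 =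
    `|\sum_(f : {ffun 'I_k -> 'I_H})
       chi (tprod f)%:R * theta (tprod f)%:R ^+ j.+1| ^+ 2.
  rewrite -muln2 exprM -normrX; congr (`|_| ^+ 2).
  rewrite -[in LHS](card_ord k) -prodr_const.
  rewrite bigA_distr_bigA /=; apply: eq_bigr => f _.
  by rewrite big_split prodrXl /= !mX.
rewrite (eq_bigr _ (fun j _ => E j)).
apply: (@mean_square _ (fun f => chi (tprod f)%:R) (fun f => (tprod f)%:R)).
by move=> f; exact: mchar_norm_le1.
Qed.

End MeanValue.

(** * The double sum in terms of a counting problem *)

Lemma card_multiples p H : prime p ->
  (#|[set x : 'I_H | (x.+1%:R == 0 :> 'F_p)%R]| <= H %/ p)%N.
Proof.
move=> p_pr; rewrite -[X in (_ <= X)%N](size_iota 1).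
have pdv x : x%:R == 0 :> 'F_p -> (p %| x)%N.
  by move/eqP/(congr1 val); rewrite /= val_Fp_nat // => /eqP.
apply: (@leq_card_inj_seq _ _ _ (fun x : 'I_H => x.+1 %/ p)%N) => [x y|x].
  rewrite !inE => /pdv xp /pdv yp /(congr1 (muln^~ p)).
  by rewrite !divnK // => -[] /val_inj.
rewrite inE mem_iota => /pdv xp; rewrite add1n ltnS leq_div2r ?ltn_ord // andbT.
by rewrite divn_gt0 ?prime_gt0 // dvdn_leq.
Qed.

(** Averaged over b this does the work of Hoelder's inequality: either b <= t,
    or b is below b * (b / t) ^ m. *)
Lemma level_bound (C : numClosedFieldType) (b t : C) m :
  0 <= b -> 0 < t -> b <= t + b ^+ m.+1 / t ^+ m.
Proof.
move=> b0 t0; have t0' : 0 <= t := ltW t0.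
have q0 : 0 <= b ^+ m.+1 / t ^+ m by rewrite divr_ge0 // exprn_ge0.
have [bt|tb] := real_leP (ger0_real b0) (ger0_real t0').
  by rewrite (le_trans bt) // lerDl.
apply: (@le_trans _ _ (b ^+ m.+1 / t ^+ m)); last by rewrite lerDr.
rewrite exprS -mulrA ler_peMr // -expr_div_n exprn_ege1 //.
by rewrite ler_pdivlMr // mul1r ltW.
Qed.

(** Here E bounds the contribution of the x divisible by p, and s stands for
    sqrt p.  The first bound is trivial in A_j; in the second, [level_bound]
    with threshold t brings in the moment of order 2k. *)
Lemma double_sum_bound (C : numClosedFieldType) p (G : {group {unit 'F_p}})
    (chi : 'F_p -> C) a H (s : C) :
  prime p -> mchar chi -> \sum_x chi x = 0 -> a != 0 -> 0 <= s -> p%:R <= s ^+ 2 ->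
  let S := \sum_(x < H) \sum_(lambda in G) chi (x.+1%:R + a * val lambda) in
  let E := (H %/ p * #|G|)%:R in
  `|S| <= E + s * H%:R /\
  forall k t, (0 < k)%N -> 0 < t ->
  `|S| <= E + s * (t + (\sum_(lambda in G) #|tprod_pairs H k (val lambda)|)%:R
                     / t ^+ k.*2.-1).
Proof.
move=> p_pr cP sc a0 s0 ps S E.
have [n [theta [nT tP tker]]] := char_with_kernel C p_pr G.
have n0 : (0 < n)%N.
  move: nT; case: n {tker} => // /esym; rewrite mul0n -subn1 => /eqP.
  by rewrite subn_eq0 leqNgt prime_gt1.
have n0' : 0 < n%:R :> C by rewrite ltr0n.
have [c [cp cE]] := sum_coset_expansion p_pr tP tker cP sc a0.
pose A (j : 'I_n) := \sum_(x < H) chi x.+1%:R * theta x.+1%:R ^+ j.+1.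
pose S' := \sum_(x < H | x.+1%:R != 0 :> 'F_p)
             \sum_(lambda in G) chi (x.+1%:R + a * val lambda).
have SE : `|S| <= E + `|S'|.
  rewrite /S (bigID (fun x : 'I_H => x.+1%:R == 0 :> 'F_p)) /=.
  apply: le_trans (ler_normD _ _) _; rewrite lerD2r.
  apply: le_trans (ler_norm_sum _ _ _) _.
  apply: (@le_trans _ _ (\sum_(x < H | x.+1%:R == 0 :> 'F_p) #|G|%:R)).
    apply: ler_sum => x _; apply: le_trans (ler_norm_sum _ _ _) _.
    rewrite -sum1_card natr_sum; apply: ler_sum => l _; exact: mchar_norm_le1.
  rewrite sumr_const -mulrnA ler_nat mulnC leq_mul //.
  by have := card_multiples H p_pr; rewrite cardsE.
have S'E : n%:R * S' = \sum_j c j * A j.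
  rewrite /S' big_distrr /=.
  under eq_bigr => x x0 do rewrite cE //.
  under [RHS]eq_bigr do rewrite big_distrr /=.
  rewrite [RHS]exchange_big /= [RHS](bigID (fun x : 'I_H => x.+1%:R != 0 :> 'F_p)) /=.
  rewrite [X in _ + X]big1 ?addr0 // => x /negPn/eqP->.
  by rewrite big1 // => j _; rewrite cP.2 mul0r mulr0.
have nS' : n%:R * `|S'| <= s * \sum_j `|A j|.
  rewrite -[n%:R]ger0_norm ?ler0n // -normrM S'E big_distrr /=.
  apply: le_trans (ler_norm_sum _ _ _) _; apply: ler_sum => j _.
  rewrite normrM; apply: ler_wpM2r => //.
  by rewrite -(@ler_pXn2r _ 2%N) ?nnegrE // (le_trans (cp j)).
have final B : \sum_j `|A j| <= n%:R * B -> `|S| <= E + s * B.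
  move=> AB; apply: le_trans SE _; rewrite lerD2l -(ler_pM2l n0').
  by apply: le_trans nS' _; rewrite mulrCA ler_wpM2l.
split; first apply: final.
  rewrite mulr_natl -[X in _ *+ X]card_ord -sumr_const; apply: ler_sum => j _.
  apply: le_trans (ler_norm_sum _ _ _) _.
  rewrite -[X in _ <= X%:R](card_ord H) -sum1_card natr_sum; apply: ler_sum => x _.
  by rewrite normrM normrX mulr_ile1 ?exprn_ge0 ?exprn_ile1 ?mchar_norm_le1.
move=> k t k0 t0; apply: final.
have kE : k.*2 = k.*2.-1.+1 by rewrite prednK // double_gt0.
apply: (@le_trans _ _ (\sum_j (t + `|A j| ^+ k.*2 / t ^+ k.*2.-1))).
  by apply: ler_sum => j _; rewrite kE; exact: level_bound.
rewrite big_split /= sumr_const card_ord mulrDr mulr_natl lerD2l.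
rewrite -big_distrl /= mulrA ler_pM2r ?invr_gt0 ?exprn_gt0 //.
exact: mean_power.
Qed.

(** * Quantitative estimates *)

(** The box count with B = m ^ 3, where m is about p ^ (1 / 6): for groups of
    order about sqrt p it saves a factor about m over the trivial count. *)
Lemma sum_card_tprod_pairs p (G : {group {unit 'F_p}}) H k M m :
  prime p -> (0 < m)%N -> (m ^ 6 <= p)%N -> (m ^ 3 <= H ^ k)%N ->
  (forall r, #|[set f : {ffun 'I_k -> 'I_H} | tprod f == r]| <= M)%N ->
  ((\sum_(lambda in G) #|tprod_pairs H k (val lambda)|) * m ^ 4 <=
     9 * M ^ 2 * (H ^ k) ^ 2 * (3 * #|G| + 2 * m ^ 3))%N.
Proof.
move=> p_pr m0 mp mH hM; set R := (H ^ k)%N in mH *.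
pose A : {set 'F_p} := [set val u | u in G].
have cA : #|A| = #|G| by apply: card_imset; exact: val_inj.
have A0 : 0 \notin A.
  by apply/imsetP => -[u _ e]; have := unit_Fp_neq0 u; rewrite -e eqxx.
have hQ : (\sum_(lambda in G) #|tprod_pairs H k (val lambda)| <=
    M ^ 2 * ((R.+1 %/ m ^ 3).+1 ^ 2 * (3 * m ^ 2 * #|G| + 2 * m ^ 5)))%N.
  apply: (@leq_trans (M ^ 2 * \sum_(l in A) #|pairs R.+1 l|)%N).
    rewrite big_imset /=; last by move=> u v _ _; exact: val_inj.
    by rewrite big_distrr; apply: leq_sum => l _; exact: card_tprod_pairs.
  by rewrite leq_mul2l -cA sum_card_pairs ?orbT.
have q0 : ((R.+1 %/ m ^ 3).+1 * m ^ 3 <= 3 * R)%N.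
  have := leq_trunc_div R.+1 (m ^ 3); have : (0 < m ^ 3)%N by rewrite expn_gt0 m0.
  by rewrite mulSn; move: (R.+1 %/ m ^ 3 * m ^ 3)%N (m ^ 3)%N mH => x y; lia.
rewrite -(leq_pmul2r (_ : 0 < m ^ 2)%N); last by rewrite expn_gt0 m0.
rewrite -mulnA -expnD; apply: leq_trans (leq_mul hQ (leqnn _)) _.
have -> : (M ^ 2 * ((R.+1 %/ m ^ 3).+1 ^ 2 * (3 * m ^ 2 * #|G| + 2 * m ^ 5)) * m ^ (4 + 2) =
  M ^ 2 * (((R.+1 %/ m ^ 3).+1 * m ^ 3) ^ 2) * ((3 * #|G| + 2 * m ^ 3) * m ^ 2))%N.
  by rewrite (_ : m ^ 5 = m ^ 3 * m ^ 2)%N -?expnD //; ring.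
rewrite mulnA leq_mul2r; apply/orP; right.
rewrite leq_mul2r; apply/orP; right.
rewrite [(9 * _)%N]mulnC -mulnA leq_mul2l; apply/orP; right.
by rewrite -[9%N]/(3 ^ 2)%N -expnMn leq_exp2r.
Qed.

(** The largest fibre M is at most D ^ k, where D is the largest number of
    divisors of an integer up to H ^ k; raising to the power e keeps everything
    in the natural numbers. *)
Lemma card_tprod_fibre H k e C :
  (forall n, (0 < n)%N -> size (divisors n) ^ e <= C * n)%N -> (0 < H)%N ->
  (0 < e)%N ->
  exists M, (M ^ e <= (C * H ^ k) ^ k)%N /\
   (forall r, #|[set f : {ffun 'I_k -> 'I_H} | tprod f == r]| <= M)%N.
Proof.
move=> hC H0 e0; pose D := (\max_(r < (H ^ k).+1) size (divisors r))%N.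
exists (D ^ k)%N; split.
  rewrite -expnM mulnC expnM; apply: leq_expl.
  have [|r rD] := @bigop.eq_bigmax _ (fun r : 'I_(H ^ k).+1 => size (divisors r)).
    by rewrite card_ord.
  rewrite /D rD; have [r0|r0] := posnP r.
    by rewrite r0 (leq_trans (hC 1%N isT)) // leq_mul2l expn_gt0 H0 orbT.
  by apply: leq_trans (hC _ r0) _; rewrite leq_mul2l -ltnS ltn_ord orbT.
move=> r; have [rH|rH] := leqP r (H ^ k).
  apply: leq_trans (card_tprod_divisors H k r) _; apply: leq_expl.
  exact: (@bigop.leq_bigmax _ (fun r : 'I_(H ^ k).+1 => size (divisors r)) (Ordinal (rH : r < (H ^ k).+1)%N)).
rewrite (_ : finset _ = set0) ?cards0 //; apply/setP => f.
rewrite !inE; apply: contraTF rH => /eqP<-.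
by rewrite -leqNgt tprod_le.
Qed.

(** If H > p, take k = 1; otherwise take the fixed exponent K with
    eps * K >= 1/2, for which the products are at most p ^ K and the divisor
    bound of order 48 K ^ 2 makes the multiplicity squared O(p ^ (1 / 24)). *)
Lemma exponent_choice (R : realType) (eps : R) : 0 < eps ->
  exists K C : nat, (0 < K)%N /\ (0 < C)%N /\
  forall p H : nat, (0 < p)%N -> p%:R `^ eps < H%:R :> R ->
  exists k M, [/\ (0 < k <= K)%N, (p <= (H ^ k) ^ 2)%N,
    forall r, (#|[set f : {ffun 'I_k -> 'I_H} | tprod f == r]| <= M)%N &
    M%:R ^+ 2 <= C%:R * p%:R `^ 24^-1 :> R].
Proof.
move=> e0; pose K := (Num.truncn (2 * eps)^-1).+1.
have K0 : (0 < K)%N by [].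
have Keps : 1 <= 2 * eps * K%:R.
  rewrite -ler_pdivrMl ?mulr_gt0 // mulr1 ltW //.
  exact: truncnS_gt.
have e0' : (0 < 48 * K ^ 2)%N by rewrite muln_gt0 expn_gt0.
have [C hC] := exists_divisor_bound e0'.
have C0 : (0 < C)%N.
  by have := hC 1%N isT; rewrite /= exp1n muln1.
exists K, C; do 2!split=> //; move=> p H p0 pH.
have p1 : 1 <= p%:R :> R by rewrite ler1n.
have pow1 : 1 <= p%:R `^ 24^-1 :> R.
  by rewrite -[X in X <= _](powRr0 (p%:R : R)) ler_powR // invr_ge0.
have H0 : (0 < H)%N by rewrite -(ltr0n R) (le_lt_trans _ pH) ?powR_ge0.
have [Hp|pH'] := leqP H p; last first.
  exists 1%N, 1%N; split=> //.
  - by rewrite expn1 (leq_trans (ltnW pH')) // -mulnn leq_pmull.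
  - exact: card_tprod1.
  - by rewrite expr1n (le_trans pow1) // ler_peMl ?powR_ge0 // ler1n.
have [M [hM fM]] := card_tprod_fibre K hC H0 e0'.
exists K, M; split; rewrite ?leqnn //.
  rewrite -(ler_nat R) natrX natrX -exprM mulnC.
  apply: (@le_trans _ _ ((p%:R `^ eps) ^+ (2 * K))); last first.
    by rewrite lerXn2r ?nnegrE ?powR_ge0 ?ler0n // ltW.
  rewrite -powR_mulrn ?powR_ge0 // -powRrM -[X in X <= _](powRr1 (ler0n R p)).
  by rewrite ler_powR // natrM; lra.
rewrite -(@ler_pXn2r _ (24 * K ^ 2)%N) ?nnegrE ?mulr_ge0 ?ler0n ?powR_ge0 //.
rewrite -exprM [X in _ <= X]exprMn mulnA -[X in _ ^+ (X * _) <= _]/48%N.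
rewrite -(powR_mulrn _ (powR_ge0 _ _)) -powRrM.
rewrite natrM mulrA mulVf ?pnatr_eq0 // mul1r powR_mulrn ?ler0n //.
rewrite -!natrX -natrM ler_nat; apply: leq_trans hM _.
rewrite expnMn leq_mul //.
  rewrite leq_pexp2l // -mulnn mulnA leq_pmull // muln_gt0 //.
by rewrite -expnM mulnn leq_exp2r // expn_gt0.
Qed.

(** With m about p ^ (1 / 6) and T <= p ^ (1/2 + eta) the moment Q is at most a
    constant times h ^ (2 k) * p ^ (1/24 + 1/2 + eta - 2/3).  That exponent is
    eta - 1/8, and the choice of kappa ensures eta - 1/8 <= - 2 k kappa for all
    k <= K; hence Q is O of the (2 k)-th power of the threshold
    h * p ^ (- kappa). *)
Lemma moment_saving (R : realType) (P h T Q M2 c m : R) (k K : nat) :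
  let kappa := (24 * K%:R)^-1 in let eta := kappa / 2 in
  1 <= P -> 0 < h -> 0 <= T -> 0 <= Q -> 0 < m -> m ^+ 6 <= P -> P <= (2 * m) ^+ 6 ->
  0 <= c -> 0 <= M2 -> (0 < k <= K)%N ->
  Q * m ^+ 4 <= 9 * M2 * (h ^+ k) ^+ 2 * (3 * T + 2 * m ^+ 3) ->
  M2 <= c * P `^ 24^-1 -> T <= P `^ (2^-1 + eta) ->
  Q / (h * P `^ (- kappa)) ^+ k.*2.-1 <= 720 * c * (h * P `^ (- kappa)).
Proof.
move=> kappa eta P1 h0 T0 Q0 m0 mP Pm c0 M0 /andP[k0 kK] hQ hM hT.
have P0 : 0 < P by exact: lt_le_trans P1.
have K0 : 0 < K%:R :> R by rewrite ltr0n (leq_trans k0).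
have kap0 : 0 < kappa by rewrite invr_gt0 mulr_gt0.
have kapK : kappa * K%:R = 24^-1 by rewrite /kappa; field; rewrite gt_eqF.
have kk : kappa * k%:R <= 24^-1 by rewrite -kapK ler_wpM2l ?ler_nat // ltW.
have kap1 : kappa <= 24^-1 by rewrite -kapK ler_peMr ?ler1n ?(leq_trans k0) // ltW.
have t0 : 0 < h * P `^ (- kappa) by rewrite mulr_gt0 ?powR_gt0.
have powX r n : (P `^ r) ^+ n = P `^ (r * n%:R).
  by rewrite -powR_mulrn ?powR_ge0 // powRrM.
have m3 : m ^+ 3 <= P `^ (2^-1 + eta).
  apply: (@le_trans _ _ (P `^ 2^-1)).
    rewrite -(@ler_pXn2r _ 2) ?nnegrE ?powR_ge0 ?exprn_ge0 ?(ltW m0) //.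
    by rewrite -exprM powX mulVf ?pnatr_eq0 // powRr1 // ltW.
  by rewrite ler_powR // lerDl divr_ge0 // ltW.
have x4 : P `^ (2 / 3) <= 16 * m ^+ 4.
  have -> : 16 * m ^+ 4 = (2 * m) ^+ 4 by rewrite exprMn -natrX.
  apply: (@le_trans _ _ ((P `^ 6^-1) ^+ 4)); first by rewrite powX ler_powR //; lra.
  rewrite lerXn2r ?nnegrE ?powR_ge0 ?mulr_ge0 ?(ltW m0) //.
  rewrite -(@ler_pXn2r _ 6) ?nnegrE ?powR_ge0 ?mulr_ge0 ?(ltW m0) //.
  by rewrite powX mulVf ?pnatr_eq0 // powRr1 // ltW.
have hk0 : 0 <= (h ^+ k) ^+ 2 by rewrite !exprn_ge0 // ltW.
have h5 : 3 * T + 2 * m ^+ 3 <= 5 * P `^ (2^-1 + eta) by move: hT m3; lra.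
have hQ2 : Q * P `^ (2 / 3) <= 720 * c * (h ^+ k) ^+ 2 * (P `^ 24^-1 * P `^ (2^-1 + eta)).
  apply: (@le_trans _ _ (16 * (Q * m ^+ 4))).
    by rewrite mulrCA ler_wpM2l.
  apply: (@le_trans _ _ (16 * (9 * M2 * (h ^+ k) ^+ 2 * (5 * P `^ (2^-1 + eta))))).
    rewrite ler_pM2l //; apply: le_trans hQ _; apply: ler_wpM2l h5.
    by rewrite mulr_ge0 // mulr_ge0.
  apply: (@le_trans _ _
    (16 * (9 * (c * P `^ 24^-1) * (h ^+ k) ^+ 2 * (5 * P `^ (2^-1 + eta))))).
    by rewrite ler_pM2l // ler_wpM2r ?mulr_ge0 ?powR_ge0 // ler_wpM2r // ler_pM2l.
  by rewrite le_eqVlt; apply/orP; left; apply/eqP; ring.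
have kE : k.*2 = k.*2.-1.+1 by rewrite prednK // double_gt0.
rewrite ler_pdivrMr ?exprn_gt0 // -[720 * c * _ * _]mulrA -exprS -kE exprMn powX.
rewrite -(@ler_pM2r _ (P `^ (2 / 3))) ?powR_gt0 //; apply: le_trans hQ2 _.
rewrite -!powRD ?(gt_eqF P0) ?implybT // -exprM muln2.
rewrite -!mulrA -powRD ?(gt_eqF P0) ?implybT //.
rewrite ler_pM2l // ler_wpM2l // ler_wpM2l ?exprn_ge0 ?(ltW h0) //.
rewrite ler_powR // /eta -muln2 natrM; lra.
Qed.

Lemma sixth_root p : (0 < p)%N ->
  exists m, [/\ (0 < m)%N, (m ^ 6 <= p)%N & (p <= (2 * m) ^ 6)%N].
Proof.
move=> p0; pose P m := (m ^ 6 <= p)%N.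
have P1 : exists m, P m by exists 1%N.
have Pb m : P m -> (m <= p)%N.
  by apply: leq_trans; case: m => // m; rewrite -[X in (X <= _)%N]expn1 leq_pexp2l.
have [m Pm m_max] := ex_maxnP P1 Pb.
have m0 : (0 < m)%N by apply: m_max.
exists m; split=> //; apply: (@leq_trans (m.+1 ^ 6)).
  by rewrite ltnW // ltnNge; apply/negP => /m_max; rewrite ltnn.
by rewrite leq_exp2r // mul2n -addnn -addn1 leq_add2l.
Qed.

Theorem theorem1 (R : realType) (eps : R) (heps : 0 < eps) :
  exists delta eta : R, 0 < delta /\ 0 < eta /\
  exists (C : R) (p0 : nat),
  forall p : nat, prime p -> (p0 <= p)%N ->
  forall (H : nat) (G : {group {unit 'F_p}}),
    (0 < H)%N ->
    p%:R `^ eps < H%:R :> R ->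
    p%:R `^ (2^-1 - delta) < #|G|%:R :> R ->
  forall (a : 'F_p) (chi : 'F_p -> R[i]),
    a != 0 -> mult_char chi -> ~ principal chi ->
    `|char_sum chi a H G| <= (C * (H%:R * #|G|%:R * p%:R `^ (- eta)))%:C.
Proof.
have [K [C [K0 [C0 hKC]]]] := exponent_choice heps.
(* half of the saving kappa is spent on sqrt p < T * p ^ delta *)
pose kappa : R := (24 * K%:R)^-1; pose eta := kappa / 2.
have K0' : 1 <= K%:R :> R by rewrite ler1n.
have kap0 : 0 < kappa by rewrite invr_gt0 mulr_gt0 // (lt_le_trans _ K0').
have eta0 : 0 < eta by rewrite divr_gt0.
have eta1 : eta <= 1.
  rewrite /eta ler_pdivrMr // mul1r /kappa invf_ple ?posrE ?mulr_gt0 ?(lt_le_trans _ K0') //.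
  by move: K0'; lra.
exists eta, eta; do 2!split=> //; exists (2 + 720 * C%:R), 0%N.
move=> p p_pr _ H G H0 pH TG a chi a0 cP cN.
have p0 := prime_gt0 p_pr.
set P : R := p%:R; set h : R := H%:R; set T : R := #|G|%:R.
have P1 : 1 <= P by rewrite ler1n.
have P0 : 0 < P by rewrite ltr0n.
have h0 : 0 < h by rewrite ltr0n.
have T0 : 0 < T by rewrite ltr0n cardG_gt0.
have sc : \sum_x chi x = 0 by case: (sum_mchar cP).
have c0 : 0 <= C%:R :> R by rewrite ler0n.
pose s : R := P `^ 2^-1.
have s0 : 0 <= s by exact: powR_ge0.
have sP : s ^+ 2 = P.
  by rewrite -powR_mulrn // -powRrM mulVf ?pnatr_eq0 // powRr1 // ltW.
have Ps : p%:R <= s%:C ^+ 2 by rewrite -rmorphXn sP rmorph_nat.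
have s0C : 0 <= s%:C by rewrite lecR.
have := double_sum_bound G H p_pr cP sc a0 s0C Ps.
have -> : \sum_(x < H) \sum_(lambda in G) chi (x.+1%:R + a * val lambda) =
    char_sum chi a H G by rewrite /char_sum big_add1 /= big_mkord.
move=> /= [bound1 bound2].
have multE : (H %/ p * #|G|)%:R <= h * T * P `^ (- eta).
  rewrite natrM mulrAC ler_wpM2r ?ler0n //.
  apply: (@le_trans _ _ (h / P)).
    by rewrite ler_pdivlMr // -natrM ler_nat leq_trunc_div.
  by rewrite ler_pM2l // -powR_inv1 ?(ltW P0) // ler_powR // lerN2.
have X0 : 0 <= h * T * P `^ (- eta) by rewrite !mulr_ge0 ?powR_ge0 ?(ltW h0) ?(ltW T0).
have fin B : s * B <= (1 + 720 * C%:R) * (h * T * P `^ (- eta)) ->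
    `|char_sum chi a H G| <= (H %/ p * #|G|)%:R + s%:C * B%:C ->
    `|char_sum chi a H G| <= ((2 + 720 * C%:R) * (h * T * P `^ (- eta)))%:C.
  move=> sB /le_trans; apply.
  by rewrite -(rmorph_nat (@real_complex R)) -rmorphM -rmorphD lecR; move: sB multE; lra.
(* for large G the trivial bound on the sums over [1, H] is enough *)
have [Tbig|Tsmall] := leP (P `^ (2^-1 + eta)) T.
  apply: (fin h); last by rewrite rmorph_nat.
  apply: (@le_trans _ _ (h * T * P `^ (- eta))); last first.
    by rewrite ler_peMl // lerDl mulr_ge0.
  rewrite mulrC -mulrA ler_pM2l // -(@ler_pM2r _ (P `^ eta)) ?powR_gt0 //.
  by rewrite /s -mulrA -!powRD ?(gt_eqF P0) ?implybT // addNr powRr0 mulr1.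
have [k [M [kK pHk fM hM]]] := hKC p H p0 pH.
have [m [m0 mp pm]] := sixth_root p0.
have mH : (m ^ 3 <= H ^ k)%N.
  by rewrite -(@leq_exp2r _ _ 2) // -expnM (leq_trans mp).
have hQ := sum_card_tprod_pairs G p_pr m0 mp mH fM.
set Q := (\sum_(lambda in G) _)%N in hQ.
(* the threshold aimed at for the mean of the |A_j| *)
pose t := h * P `^ (- kappa).
have t0 : 0 < t by rewrite mulr_gt0 ?powR_gt0.
have saving : Q%:R / t ^+ k.*2.-1 <= 720 * C%:R * t.
  apply: (@moment_saving R P h T Q%:R (M%:R ^+ 2) C%:R m%:R k K) => //.
  - by rewrite ltr0n.
  - by rewrite -natrX ler_nat.
  - by rewrite -natrM -natrX ler_nat.
  - exact: exprn_ge0.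
  - by rewrite -!natrX -!natrM -natrD -natrM ler_nat.
  - exact: ltW.
apply: (fin (t + Q%:R / t ^+ k.*2.-1)); last first.
  have k0 : (0 < k)%N by case/andP: kK.
  have tC : 0 < t%:C by rewrite ltcR.
  have -> (x : R) n : (x + Q%:R / x ^+ n)%:C = x%:C + Q%:R / x%:C ^+ n.
    by rewrite rmorphD rmorphM fmorphV rmorphXn rmorph_nat.
  exact: bound2.
apply: (@le_trans _ _ (s * ((1 + 720 * C%:R) * t))).
  by rewrite ler_wpM2l // mulrDl mul1r lerD2l.
rewrite mulrCA ler_wpM2l ?addr_ge0 ?mulr_ge0 //.
rewrite /t mulrCA -mulrA ler_pM2l // -powRD ?(gt_eqF P0) ?implybT //.
have -> : 2^-1 - kappa = (2^-1 - eta) - eta by rewrite /eta; lra.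
by rewrite powRD ?(gt_eqF P0) ?implybT // ler_wpM2r ?powR_ge0 // ltW.
Qed.
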